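(* Let $\succeq$ be a standard preference on $X=\Delta([a,b])^S$ with standard representation $(V,u)$, and let $\{\succeq^k\}_{k\ge1}$ be a sequence of standard preferences on $X$, each $\succeq^k$ having a standard representation $(V^k,u^k)$. (1) If $\succeq^k\to\succeq$ in the topology of closed convergence, then $u^k\to u$ and $V^k\to V$ in the compact-open topology (i.e. uniformly on compact sets; equivalently, $u^k(x^k)\to u(x)$ whenever $x^k\to x$ in $[a,b]$, and $V^k(f^k)\to V(f)$ whenever $f^k\to f$ in $X$). (2) If, in addition, all these preferences are aggregative, with aggregative representations $(V^k,u^k,H^k)$ and $(V,u,H)$, then $H^k\to H$ in the compact-open topology on functions $[0,1]^S\to\mathbf{R}$ (equivalently, $H^k(z^k)\to H(z)$ whenever $z^k\to z$ in $[0,1]^S$).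
   Context: Let $S$ be a finite nonempty set and $a<b$ real numbers. $\Delta([a,b])$ denotes the set of Borel probability measures on $[a,b]$ with the topology of weak convergence of measures; $X=\Delta([a,b])^S$ (the set of acts) carries the product topology. For $p\in\Delta([a,b])$, $(p,\dots,p)$ is the constant act equal to $p$; $\delta_x$ is the point mass at $x$. For $p,q\in\Delta([a,b])$, $p$ first-order stochastically dominates $q$ if $\int h\,dp\ge\int h\,dq$ for every bounded continuous nondecreasing $h:[a,b]\to\mathbf{R}$; an act $f$ dominates $g$ if $f(s)$ first-order stochastically dominates $g(s)$ for all $s\in S$. A preference on a topological space $Y$ is a complete and transitive binary relation $\succeq$ that is closed as a subset of $Y\times Y$. A preference $\succeq$ on $X$ is weakly monotone if $f\succeq g$ whenever $f$ dominates $g$. Let $\mathcal U$ be the set of continuous nondecreasing $u:[a,b]\to\mathbf{R}$ with $u(a)=0$, $u(b)=1$. A pair $(V,u)$ is a standard representation if $V:X\to\mathbf{R}$ is continuous, $u\in\mathcal U$, and $V(p,\dots,p)=\int_{[a,b]}u\,dp$ for every $p\in\Delta([a,b])$. A preference $\succeq$ on $X$ is standard if it is weakly monotone and there is a standard representation $(V,u)$ with $V$ representing $\succeq$ (i.e. $f\succeq g\iff V(f)\ge V(g)$). A standard representation $(V,u)$ is aggregative if there is $H:[0,1]^S\to\mathbf{R}$ (the aggregator) with $V(f)=H\big((\int u\,df(s))_{s\in S}\big)$ for all $f\in X$; this is written $(V,u,H)$, and a standard preference is aggregative if it has an aggregative standard representation. Closed convergence: for a sequence $\mathcal F=\{F^n\}$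 of closed subsets of $X\times X$, $\mathrm{Li}(\mathcal F)$ is the set of points $z$ such that every neighborhood of $z$ meets $F^n$ for all sufficiently large $n$, and $\mathrm{Ls}(\mathcal F)$ the set of points $z$ such that every neighborhood of $z$ meets $F^n$ for infinitely many $n$. $F^n\to F$ in the topology of closed convergence iff $\mathrm{Li}(\mathcal F)=F=\mathrm{Ls}(\mathcal F)$. Preferences, as closed subsets of $X\times X$, converge in this sense. *)

(* Defs.v *)
From HB Require Import structures.
From mathcomp Require Import all_boot all_order all_algebra.
From mathcomp Require Import all_classical all_reals all_analysis.
Set Implicit Arguments. Unset Strict Implicit. Unset Printing Implicit Defensive.
Import Order.TTheory GRing.Theory Num.Theory numFieldNormedType.Exports.
Local Open Scope classical_set_scope.
Local Open Scope ring_scope.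

Section Prefs.
Variables (R : realType) (a b : R) (S : finType).

(* Delta([a,b]) : Borel probability measures on R concentrated on [a,b]
   (canonically identified with Borel probability measures on [a,b]). *)
Record lottery := Lottery {
  lot :> probability R R;
  lot_supp : lot `[a, b]%classic = 1%E }.

Definition act := S -> lottery.

Definition const_act (p : lottery) : act := fun _ => p.

Definition cont_ab (h : R -> R) : Prop := {within `[a, b]%classic, continuous h}.

Definition expect (p : lottery) (h : R -> R) : R :=
  fine (\int[p]_(x in `[a, b]%classic) (h x)%:E).

(* Basic open neighbourhood of an act f in the (product of) weak topologies:
   finitely many continuous test functions hs j, tolerance e, all states. *)
Definition wnbhd (n : nat) (hs : 'I_n -> R -> R) (e : R) (f f' : act) : Prop :=
  forall (j : 'I_n) (s : S), `|expect (f' s) (hs j) - expect (f s) (hs j)| < e.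

Definition admissible (n : nat) (hs : 'I_n -> R -> R) (e : R) : Prop :=
  (forall j, cont_ab (hs j)) /\ 0 < e.

Definition wnbhd2 (n : nat) (hs : 'I_n -> R -> R) (e : R) (z z' : act * act) : Prop :=
  wnbhd hs e z.1 z'.1 /\ wnbhd hs e z.2 z'.2.

Definition closedXX (F : act * act -> Prop) : Prop :=
  forall z, (forall (n : nat) (hs : 'I_n -> R -> R) e, admissible hs e ->
               exists z', F z' /\ wnbhd2 hs e z z') -> F z.

Definition Li (Fk : nat -> act * act -> Prop) (z : act * act) : Prop :=
  forall (n : nat) (hs : 'I_n -> R -> R) e, admissible hs e ->
    exists K, forall k, (K <= k)%N -> exists z', Fk k z' /\ wnbhd2 hs e z z'.
Definition Ls (Fk : nat -> act * act -> Prop) (z : act * act) : Prop :=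
  forall (n : nat) (hs : 'I_n -> R -> R) e, admissible hs e ->
    forall K, exists k, (K <= k)%N /\ exists z', Fk k z' /\ wnbhd2 hs e z z'.
Definition closed_conv (Fk : nat -> act * act -> Prop) (F : act * act -> Prop) :=
  forall z, (Li Fk z <-> F z) /\ (Ls Fk z <-> F z).

Definition pref_set (P : act -> act -> Prop) : act * act -> Prop :=
  fun z => P z.1 z.2.

Definition preference (P : act -> act -> Prop) : Prop :=
  (forall f g, P f g \/ P g f) /\
  (forall f g h, P f g -> P g h -> P f h) /\
  closedXX (pref_set P).

Definition fosd (p q : lottery) : Prop :=
  forall h : R -> R, cont_ab h -> {in `[a, b] &, {homo h : x y / x <= y}} ->
    expect q h <= expect p h.

Definition dominates (f g : act) : Prop := forall s, fosd (f s) (g s).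

Definition weakly_monotone (P : act -> act -> Prop) : Prop :=
  forall f g, dominates f g -> P f g.

Definition contX (V : act -> R) : Prop :=
  forall f (eps : R), 0 < eps -> exists (n : nat) (hs : 'I_n -> R -> R) e, admissible hs e /\
    forall f', wnbhd hs e f f' -> `|V f' - V f| < eps.

Definition in_U (u : R -> R) : Prop :=
  cont_ab u /\ {in `[a, b] &, {homo u : x y / x <= y}} /\ u a = 0 /\ u b = 1.

Definition std_rep (V : act -> R) (u : R -> R) : Prop :=
  contX V /\ in_U u /\ forall p, V (const_act p) = expect p u.

Definition represents (V : act -> R) (P : act -> act -> Prop) : Prop :=
  forall f g, P f g <-> V g <= V f.

Definition standard_pref (P : act -> act -> Prop) : Prop :=
  preference P /\ weakly_monotone P /\
  exists V u, std_rep V u /\ represents V P.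

(* aggregator H : [0,1]^S -> R (values outside [0,1]^S are irrelevant) *)
Definition aggregative (V : act -> R) (u : R -> R) (H : (S -> R) -> R) : Prop :=
  std_rep V u /\ forall f, V f = H (fun s => expect (f s) u).

(* compact-open convergence on the compact domains = uniform convergence *)
Definition unif_ab (uk : nat -> R -> R) (u : R -> R) : Prop :=
  forall eps : R, 0 < eps -> exists K, forall k, (K <= k)%N ->
    forall x, x \in `[a, b] -> `|uk k x - u x| < eps.

Definition unif_X (Vk : nat -> act -> R) (V : act -> R) : Prop :=
  forall eps : R, 0 < eps -> exists K, forall k, (K <= k)%N ->
    forall f, `|Vk k f - V f| < eps.

Definition unif_cube (Hk : nat -> (S -> R) -> R) (H : (S -> R) -> R) : Prop :=
  forall eps : R, 0 < eps -> exists K, forall k, (K <= k)%N ->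
    forall z : S -> R, (forall s, 0 <= z s <= 1) -> `|Hk k z - H z| < eps.

End Prefs.

(* Main.v *)
Require Import Defs.
From HB Require Import structures.
From mathcomp Require Import all_boot all_order all_algebra.
From mathcomp Require Import all_classical all_reals all_analysis.
From mathcomp Require Import measurable_realfun lra ring.
Set Implicit Arguments.
Unset Strict Implicit.
Unset Printing Implicit Defensive.
Import Order.TTheory GRing.Theory Num.Theory numFieldNormedType.Exports.
Local Open Scope classical_set_scope.
Local Open Scope ring_scope.

(* The lottery on {a, b} giving b the probability t has value t under every
   standard representation, and by weak monotonicity all values lie in [0, 1].
   If f^k -> f while V^k(f^k) >= V(f) + e infinitely often, then f^k is weakly
   preferred, for these k, to the constant lottery of value V(f) + e; closed
   convergence passes this to f, which is absurd. The other inequality is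
   symmetric. Uniformity in f follows because X is compact; here compactness
   is used along an ultrafilter on the indices k. Point masses and lotteries on
   {a, b} then turn the convergence of V^k into that of u^k and H^k. *)

(** Since [c] is upward closed, the sum telescopes from the first index where [c] holds; [j] is that
    index, or [n] if [c] fails below [n]. *)
Lemma step_sum (R : pzRingType) (g : nat -> R) (c : nat -> bool) n :
  (forall i, c i -> c i.+1) ->
  exists j, [/\ (j <= n)%N, (j < n)%N -> c j, (0 < j)%N -> ~~ c j.-1 &
    g n + \sum_(i < n) (g i - g i.+1) * (c i)%:R = g j].
Proof.
move=> cS; elim: n => [|n [j [jn cj ncj gj]]].
  by exists 0%N; split; rewrite // big_ord0 addr0.
have [cn|ncn] := boolP (c n).
  exists j; split => //; first exact: leqW.
  - by rewrite ltnS leq_eqVlt => /predU1P[->|/cj].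
  - by rewrite -gj big_ord_recr/= cn mulr1 addrCA subrKC addrC.
exists n.+1; split; rewrite ?ltnn// big1 ?addr0// => i _.
suff /negbTE-> : ~~ c i by rewrite mulr0.
apply: contra ncn => ci; have : (i <= n)%N by rewrite -ltnS.
elim: n {gj jn cj ncj i}(nat_of_ord i) ci => [|n IH] i ci.
  by rewrite leqn0 => /eqP <-.
by rewrite leq_eqVlt => /predU1P[<-//|/IH-/(_ ci)/cS].
Qed.

(** * Retraction onto the interval, uniform continuity and grids *)

Section Clip.
Context {R : realType} (a b : R).
Hypothesis ab : a <= b.

(** The retraction of the line onto [[a, b]]: composing with it turns a function continuous within
    the interval into one continuous everywhere. *)
Definition clip (x : R) : R := Num.max a (Num.min b x).

Lemma clip_in x : a <= clip x <= b.
Proof. by rewrite /clip le_max lexx/= ge_max ab ge_min lexx. Qed.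

Lemma clip_id x : a <= x <= b -> clip x = x.
Proof. by case/andP=> ax xb; rewrite /clip (min_idPr xb) (max_idPr ax). Qed.

Lemma clip_nd : {homo clip : x y / x <= y}.
Proof.
move=> x y xy; rewrite /clip; have ab' := ab.
case: (leP b x) => ?; case: (leP b y) => ?;
  by case: (leP a b) => ?; case: (leP a x) => ?; case: (leP a y) => ?; lra.
Qed.

Lemma clip_lip x y : `|clip x - clip y| <= `|x - y|.
Proof.
have ab' := ab; wlog yx : x y / y <= x => [wl|].
  have [/wl//|/ltW/wl] := leP y x.
  by rewrite distrC (distrC y).
rewrite (ger0_norm (x := x - y)) ?subr_ge0// ger0_norm ?subr_ge0 ?clip_nd//.
rewrite /clip; case: (leP b x) => ?; case: (leP b y) => ?;
  by case: (leP a b) => ?; case: (leP a x) => ?; case: (leP a y) => ?; lra.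
Qed.

Lemma cont_clip (h : R -> R) x : cont_ab a b h -> {for x, continuous (h \o clip)}.
Proof.
move=> ch; apply/cvgrPdist_lt => e e0.
have cx : `[a, b]%classic (clip x) by rewrite /= in_itv/= clip_in.
have /subspace_continuousP/(_ _ cx)/cvgrPdist_lt/(_ e e0) := ch.
rewrite /prop_near1 /within/= => -[d /= d0 hd].
exists d => //= y /= xy; apply: hd.
  by rewrite /ball/=; apply: le_lt_trans xy; exact: clip_lip.
by rewrite in_itv/= clip_in.
Qed.

Lemma unif_cont_clip (h : R -> R) (e : R) : cont_ab a b h -> 0 < e ->
  exists2 d, 0 < d & forall x y, a <= x <= b -> a <= y <= b ->
    `|x - y| < d -> `|h x - h y| < e.
Proof.
move=> ch e0.
(* Heine-Cantor by compactness. The covering neighbourhoods live in the whole line and may leave the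
   interval, hence [clip] around [x]. *)
have /compact_near_coveringP/(_ R (0^'+)
    (fun d x => forall y, a <= y <= b -> `|x - y| < d -> `|h (clip x) - h y| < e)) :=
  @segment_compact R a b.
case=> [x _ |].
  have /cvgrPdist_lt/(_ (e/2)) := cont_clip (x := x) ch.
  case=> [|r /= r0 hr]; first by rewrite divr_gt0.
  exists (ball x (r/2), [set d | d < r/2]) => /=.
    split; first by apply: nbhsx_ballx; rewrite divr_gt0.
    by apply: nbhs_right_lt; rewrite divr_gt0.
  move=> [x' d]/= [x'r dr] y yab yd.
  rewrite /ball/= in x'r; move: (hr x') (hr y); rewrite /ball/= (clip_id yab) => h1 h2.
  have {}h1 : `|h (clip x) - h (clip x')| < e / 2 by apply: h1; lra.
  have {}h2 : `|h (clip x) - h y| < e / 2.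
    apply: h2; rewrite (_ : x - y = (x - x') + (x' - y)); last by ring.
    by apply: le_lt_trans (ler_normD _ _) _; lra.
  rewrite (_ : _ - _ = - (h (clip x) - h (clip x')) + (h (clip x) - h y)); last by ring.
  by apply: le_lt_trans (ler_normD _ _) _; rewrite normrN; lra.
move=> d /= d0 hd; exists (d/2); first by rewrite divr_gt0.
move=> x y xab yab xyd; have := hd (d/2).
rewrite /= sub0r normrN gtr0_norm ?divr_gt0//.
move=> /(_ ltac:(lra) ltac:(lra) x); rewrite /= in_itv/= clip_id//.
by move=> /(_ xab y yab xyd).
Qed.

(** Equally spaced points whose step is below a modulus of uniform continuity. At [i = 0] the
    predecessor is again [0], so the first cell is the single point [a]. *)
Lemma cont_grid (h : R -> R) (e : R) : cont_ab a b h -> 0 < e ->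
  exists n (x : nat -> R), [/\ x 0 = a, x n = b, nondecreasing_seq x &
    forall i, (i <= n)%N -> forall y, a <= y <= b -> x i.-1 <= y <= x i ->
      `|h y - h (x i)| < e].
Proof.
move=> ch e0; have [d d0 hd] := unif_cont_clip ch e0.
have [n dn] : exists n : nat, (b - a) / d < n%:R.
  by exists (Num.bound ((b - a) / d)); rewrite archi_boundP// divr_ge0 ?subr_ge0// ltW.
have n0 : 0 < n%:R :> R by apply: le_lt_trans dn; rewrite divr_ge0 ?subr_ge0// ltW.
pose x i := a + i%:R * ((b - a) / n%:R).
have sd : (b - a) / n%:R < d by rewrite ltr_pdivrMr// -ltr_pdivrMl// mulrC.
have s0 : 0 <= (b - a) / n%:R by rewrite divr_ge0 ?subr_ge0// ltW.
have xnd : nondecreasing_seq x.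
  by move=> i j ij; rewrite lerD2l ler_wpM2r// ler_nat.
have x0 : x 0 = a by rewrite /x mul0r addr0.
have xn : x n = b by rewrite /x mulrC divfK ?gt_eqF// subrKC.
exists n, x; split => // i iN y yab /andP[y1 y2].
apply: hd => //.
  by rewrite -x0 -xn !xnd.
rewrite distrC ger0_norm ?subr_ge0//.
case: i iN y1 y2 => [|i] iN /= y1 y2; first by move: yab; lra.
by move: y1 y2; rewrite /x -natr1 [(i%:R + 1) * _]mulrDl mul1r; lra.
Qed.

End Clip.

Section ClipMeasurable.
Context {R : realType} (a b : R).
Hypothesis ab : a <= b.

Lemma measurable_clip : measurable_fun [set: R] (clip a b).
Proof.
by apply: nondecreasing_measurable => // x y; exact: clip_nd.
Qed.

Lemma measurable_cont_clip (h : R -> R) : cont_ab a b h ->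
  measurable_fun [set: R] (h \o clip a b).
Proof.
by move=> ch; apply: continuous_measurable_fun => x; exact: cont_clip.
Qed.

Lemma cont_bounded (h : R -> R) : cont_ab a b h ->
  exists M, forall x, a <= x <= b -> `|h x| <= M.
Proof.
move=> ch; have [c _ hc] := EVT_max ab ch; have [d _ hd] := EVT_min ab ch.
exists (`|h c| + `|h d|) => x xab.
have := hc x; have := hd x; rewrite in_itv/= => /(_ xab) h1 /(_ xab) h2.
have h3 := ler_norm (h c); have h4 := lerNnormlW (lexx `|h d|).
have := normr_ge0 (h c); have := normr_ge0 (h d).
by rewrite ler_norml; lra.
Qed.

End ClipMeasurable.

(** * Integrals of bounded functions and of step functions under a probability *)

Section ProbabilityIntegral.
Context {d} {T : measurableType d} {R : realType} (P : probability T R).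

Lemma integrable_bounded (f : T -> R) (M : R) : measurable_fun setT f ->
  (forall x, `|f x| <= M) -> P.-integrable setT (EFin \o f).
Proof.
move=> mf fM; apply: measurable_bounded_integrable => //.
  by apply: le_lt_trans (probability_le1 P _) _ => //; rewrite ltry.
exists M; split; first exact: num_real.
by move=> N MN x _ /=; apply: le_trans (fM x) (ltW MN).
Qed.

Lemma Rintegral_prob_cst (r : R) : \int[P]_x r = r.
Proof.
rewrite Rintegral_cst//.
have -> : fine (P setT) = 1 by rewrite probability_setT.
by rewrite mulr1.
Qed.

Lemma integrable_steps (c : R) (w : nat -> R) (A : nat -> set T) n :
  (forall i, measurable (A i)) ->
  P.-integrable setT (EFin \o (fun x => c + \sum_(i < n) w i * \1_(A i) x)).
Proof.
move=> mA; apply: (@integrable_bounded _ (`|c| + \sum_(i < n) `|w i|)).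
  apply: measurable_funD => //; apply: measurable_sum => i.
  by apply: measurable_funM => //; exact: measurable_indic.
move=> x; apply: le_trans (ler_normD _ _) _; rewrite lerD2l.
apply: le_trans (ler_norm_sum _ _ _) _; apply: ler_sum => i _.
rewrite normrM ler_piMr// indicE; case: (_ \in _); rewrite ?normr0 ?normr1//.
Qed.

Lemma Rintegral_steps (c : R) (w : nat -> R) (A : nat -> set T) n :
  (forall i, measurable (A i)) ->
  \int[P]_x (c + \sum_(i < n) w i * \1_(A i) x) =
  c + \sum_(i < n) w i * fine (P (A i)).
Proof.
move=> mA; elim: n => [|n IH].
  under eq_Rintegral do rewrite big_ord0 addr0.
  by rewrite big_ord0 addr0 Rintegral_prob_cst.
under eq_Rintegral do rewrite big_ord_recr/= addrA.
have iA : P.-integrable setT (EFin \o \1_(A n)).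
  apply: (@integrable_bounded _ 1); first exact: measurable_indic.
  by move=> x; rewrite indicE; case: (_ \in _); rewrite ?normr0 ?normr1.
rewrite RintegralD//; last 2 first.
  exact: integrable_steps.
  apply: (@integrable_bounded _ `|w n|).
    by apply: measurable_funM => //; exact: measurable_indic.
  by move=> x; rewrite normrM ler_piMr// indicE; case: (_ \in _); rewrite ?normr0 ?normr1.
rewrite IH RintegralZl// big_ord_recr/= addrA; congr (_ + _ * _).
by rewrite /Rintegral integral_indic// setIT.
Qed.

Lemma Rintegral_close (f g : T -> R) (e : R) :
  P.-integrable setT (EFin \o f) -> P.-integrable setT (EFin \o g) ->
  (forall x, `|f x - g x| <= e) -> `|\int[P]_x f x - \int[P]_x g x| <= e.
Proof.
move=> intf intg fg; rewrite -RintegralB//.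
have intfg : P.-integrable setT (EFin \o (fun x => f x - g x)).
  by have := integrableB measurableT intf intg.
apply: le_trans (le_normr_Rintegral _ intfg) _ => //.
rewrite -[leRHS]Rintegral_prob_cst; apply: le_Rintegral => //.
  exact: integrable_norm.
by apply: (@integrable_bounded _ `|e|).
Qed.

(* A Riemann-Stieltjes sum in Abel-summed form: [\1_(A i)] plays the role of
   the event [X <= x i], but either answer is allowed when [X = x i]. *)
Lemma Rintegral_step_approx (a b : R) (h : R -> R) (X : T -> R) (x : nat -> R)
    (n : nat) (A : nat -> set T) (e : R) :
  a <= b -> cont_ab a b h -> measurable_fun setT X -> (forall t, a <= X t <= b) ->
  x 0 = a -> x n = b -> nondecreasing_seq x ->
  (forall i, (i <= n)%N -> forall y, a <= y <= b -> x i.-1 <= y <= x i ->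
      `|h y - h (x i)| < e) ->
  (forall i, measurable (A i)) -> (forall i, A i `<=` A i.+1) ->
  (forall i t, A i t -> X t <= x i) ->
  (forall i t, (i < n)%N -> ~ A i t -> x i <= X t) ->
  `|\int[P]_t h (X t) -
     (h b + \sum_(i < n) (h (x i) - h (x i.+1)) * fine (P (A i)))| <= e.
Proof.
move=> ab ch mX Xab x0 xn xnd hx mA AS AX XA.
rewrite -(Rintegral_steps _ (fun i => h (x i) - h (x i.+1)))//.
have [M hM] := cont_bounded ab ch.
apply: Rintegral_close => [||t].
- apply: (@integrable_bounded _ M) => [|t]; last exact: hM.
  apply: (@eq_measurable_fun _ _ _ _ setT ((h \o clip a b) \o X)).
    by move=> t _ /=; rewrite clip_id.
  by apply: measurableT_comp mX; exact: measurable_cont_clip.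
- exact: (integrable_steps _ (fun i => h (x i) - h (x i.+1))).
(* At the point [t] the step function telescopes to [h (x j)], where [j] is the first index with [t]
   in [A j] (or [n]). Then [X t] lies between [x j.-1] and [x j], and the grid estimate applies. *)
have [|j [jn cj ncj]] := @step_sum R (h \o x) (fun i => t \in A i) n.
  by move=> i /set_mem/AS/mem_set.
rewrite /= xn; under eq_bigr do rewrite -indicE.
move=> ->; apply/ltW/hx => //; apply/andP; split.
  case: j {cj} jn ncj => [|j] jn /= ncj; first by rewrite x0; case/andP: (Xab t).
  by apply: XA => //; move=> /mem_set tA; have := ncj isT; rewrite tA.
move: jn; rewrite leq_eqVlt => /predU1P[->|jn].
  by rewrite xn; case/andP: (Xab t).
by apply/AX/set_mem/cj.
Qed.

End ProbabilityIntegral.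

(** * Expectations under lotteries, and construction of lotteries *)

Section Lotteries.
Context {R : realType} (a b : R).
Hypothesis ab : a <= b.

(** A lottery gives no mass to the complement of [[a, b]], and [clip] is the identity on the
    interval. *)
Lemma expect_clip (p : lottery a b) (h : R -> R) : cont_ab a b h ->
  expect p h = \int[lot p]_x h (clip a b x).
Proof.
move=> ch; have mab : measurable (`[a, b]%classic : set R) by [].
have out0 : lot p (~` `[a, b]%classic) = 0%E.
  by rewrite probability_setC// (lot_supp p) subee.
have [M hM] := cont_bounded ab ch.
have int : (lot p).-integrable setT (EFin \o (h \o clip a b)).
  apply: (@integrable_bounded _ _ _ _ _ M); first exact: measurable_cont_clip.
  by move=> x; apply: hM; exact: clip_in.
rewrite /Rintegral (@negligible_integral _ _ _ _ _ (~` `[a, b]%classic))//.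
- rewrite setTD setCK /expect; congr fine; apply: eq_integral => x.
  by rewrite inE/= in_itv/= => xab; rewrite clip_id.
- exact: measurableC.
Qed.

Lemma expect_le (p : lottery a b) (h g : R -> R) :
  cont_ab a b h -> cont_ab a b g -> (forall x, a <= x <= b -> h x <= g x) ->
  expect p h <= expect p g.
Proof.
move=> ch cg hg; rewrite !expect_clip//.
have [M hM] := cont_bounded ab ch; have [N gN] := cont_bounded ab cg.
apply: le_Rintegral => //.
- apply: (@integrable_bounded _ _ _ _ _ M); first exact: measurable_cont_clip.
  by move=> x; apply: hM; exact: clip_in.
- apply: (@integrable_bounded _ _ _ _ _ N); first exact: measurable_cont_clip.
  by move=> x; apply: gN; exact: clip_in.
- by move=> x _; apply: hg; exact: clip_in.
Qed.

Lemma expect_cst (p : lottery a b) (r : R) : expect p (fun=> r) = r.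
Proof.
rewrite expect_clip ?Rintegral_prob_cst//.
by apply: continuous_subspaceT => x; exact: cvg_cst.
Qed.

Local Notation unif01 := (uniform_prob (@ltr01 R)).

Lemma uniform_le (g : R) : 0 <= g <= 1 -> fine (unif01 [set t | t <= g]) = g.
Proof.
move=> /andP[g0 g1]; rewrite /uniform_prob integral_uniform_pdf.
rewrite (_ : _ `&` _ = `[0, g]%classic); last first.
  apply/seteqP; split=> t /=; rewrite !in_itv/=; first by case=> -> /andP[->].
  by move=> /andP[-> tg]; rewrite tg (le_trans tg).
rewrite (eq_integral (fun=> 1%E)).
  rewrite integral_cst//= mul1e lebesgue_measure_itv/= lte_fin.
  by case: ltP => [_|g0']; rewrite ?sube0//; apply/eqP; rewrite eq_le g0 g0'.
move=> t; rewrite inE/= in_itv/= => /andP[t0 tg].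
by rewrite /uniform_pdf t0 (le_trans tg g1) subr0 invr1.
Qed.

(** The lottery is the law of [Q] under the uniform distribution on the unit interval. Point masses,
    lotteries on [{a, b}] and weak limits all arise from this by a choice of [Q]. *)
Lemma lottery_of_quantile (Q : measurableTypeR R -> R) :
  measurable_fun setT Q ->
  (forall t, a <= Q t <= b) ->
  exists q : lottery a b, forall h, cont_ab a b h ->
    expect q h = \int[unif01]_t h (Q t).
Proof.
move=> mQ Qab; pose mixin := isMeasurableFun.Build _ _ _ _ Q mQ.
pose X : {mfun measurableTypeR R >-> R} := HB.pack Q mixin.
have Xab : X @^-1` `[a, b]%classic = setT.
  by apply/seteqP; split=> // t _; rewrite /= in_itv/= Qab.
have supp : distribution (unif01 : probability _ _) X `[a, b]%classic = 1%E.
  by rewrite /distribution /pushforward Xab probability_setT.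
exists (Lottery supp) => h ch; rewrite expect_clip//.
have [M hM] := cont_bounded ab ch.
rewrite /Rintegral /= /distribution integral_pushforward//=.
- by congr fine; apply: eq_integral => t _ /=; rewrite clip_id.
- by apply/measurable_EFinP; exact: measurable_cont_clip.
- rewrite preimage_setT; apply: (@integrable_bounded _ _ _ _ ((h \o clip a b) \o Q) M).
    exact: measurableT_comp (measurable_cont_clip ab ch) mQ.
  by move=> t; apply: hM; exact: clip_in.
Qed.

Lemma exists_dirac_lottery (x : R) : a <= x <= b ->
  exists q : lottery a b, forall h, cont_ab a b h -> expect q h = h x.
Proof.
move=> xab; have [||q hq] := @lottery_of_quantile (fun=> x) => //.
by exists q => h ch; rewrite hq// Rintegral_prob_cst.
Qed.

(** Mass [t] at [b] and the rest at [a]. As every [u] in the class is 0 at [a] and 1 at [b], a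
    single lottery serves all utilities at once, so it can be compared across the whole sequence of
    preferences. *)
Lemma exists_binary_lottery (t : R) : 0 <= t <= 1 ->
  exists q : lottery a b, forall u, in_U a b u -> expect q u = t.
Proof.
move=> t01; have mt : measurable [set s : R | s <= t].
  by rewrite -[X in measurable X]/(`]-oo, t]%classic).
have [||q hq] := @lottery_of_quantile (fun s => a + (b - a) * \1_[set s | s <= t] s).
- by apply: measurable_funD => //; apply: measurable_funM => //; exact: measurable_indic.
- by move=> s; rewrite indicE; case: (_ \in _); rewrite ?mulr1 ?mulr0; have := ab; lra.
exists q => u [cu [_ [ua ub]]]; rewrite hq//.
transitivity (\int[unif01]_s (0 + \sum_(i < 1) 1 * \1_[set s | s <= t] s)).
  apply: eq_Rintegral => s _; rewrite big_ord1 add0r mul1r indicE.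
  by case: (_ \in _); rewrite ?mulr1 ?mulr0 ?addr0 ?subrKC.
have := @Rintegral_steps _ _ _ unif01 0 (fun=> 1) (fun=> [set s | s <= t]) 1 (fun=> mt).
by move=> ->; rewrite big_ord1 add0r mul1r uniform_le.
Qed.

End Lotteries.

(** * Compactness of lotteries along an ultrafilter *)

Section Compactness.
Context {R : realType} (U : set_system nat) {UU : UltraFilter U}.

(** Compactness gives a cluster point, and an ultrafilter converges to it: otherwise the complement
    of the preimage of some neighbourhood would belong to [U]. *)
Lemma ultra_cvg_unit (c : nat -> R) : (forall k, 0 <= c k <= 1) ->
  exists2 l : R, 0 <= l <= 1 & c k @[k --> U] --> l.
Proof.
move=> c01; have [|l [l01 lc]] := @segment_compact R 0 1 (c @ U).
  by apply: nearW => k; rewrite /= in_itv/= c01.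
exists l; first by move: l01; rewrite /= in_itv.
move=> N Nl; have [//|UN] := in_ultra_setVsetC (c @^-1` N) UU.
by have [x [nNx /nNx]] := lc (~` N) N UN Nl.
Qed.

Variables a b : R.
Hypothesis ab : a <= b.

(* Helly selection in quantile form: if [G] is the pointwise limit of the
   distribution functions, then [Q t <= x] and [t <= G x] agree except possibly
   on the boundary [Q t = x], so [Q] pushes the uniform law to the limit, and no
   continuity point of [G] is needed. *)
Lemma lottery_ultra_compact (p : nat -> lottery a b) :
  exists q : lottery a b, forall h, cont_ab a b h ->
    expect (p k) h @[k --> U] --> expect q h.
Proof.
pose F k x := fine (lot (p k) [set y | clip a b y <= x]).
have mclip x : measurable [set y : R | clip a b y <= x].
  have := @measurable_clip R a b ab measurableT `]-oo, x]%classic.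
  by rewrite setTI; apply.
have Ffin k (x : R) : lot (p k) [set y | clip a b y <= x] \is a fin_num.
  exact: fin_num_measure.
have F01 x k : 0 <= F k x <= 1.
  rewrite fine_ge0//= -lee_fin fineK//; exact: probability_le1.
have /choice[G HG] : forall x, exists l : R, 0 <= l <= 1 /\ F k x @[k --> U] --> l.
  by move=> x; have [l l01 Fl] := ultra_cvg_unit (F01 x); exists l.
have Gnd x y : x <= y -> G x <= G y.
  move=> xy; apply: ler_cvg_to (HG x).2 (HG y).2 _.
  apply: nearW => k; rewrite /F fine_le// le_measure ?inE// => z /= zx.
  exact: le_trans zx xy.
(* [Q] is the generalized inverse of [G]; adjoining [a] keeps the set nonempty, so that its supremum
   lies in [[a, b]]. *)
pose E t := [set y | y = a \/ a <= y <= b /\ G y < t].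
pose Q t := sup (E t).
have Ea t : E t a by left.
have Eub t : has_sup (E t).
  by split; [exists a|exists b => y [->//|[/andP[]]]].
have Qab t : a <= Q t <= b.
  apply/andP; split; first exact: sup_upper_bound.
  by apply: ge_sup; [exists a|move=> y [->//|[/andP[]]]].
have Qnd : nondecreasing_fun Q.
  move=> s t st; apply: ge_sup; first by exists a.
  move=> y [->|[yab ys]]; apply: sup_upper_bound => //.
  by right; split => //; apply: lt_le_trans st.
have QG x t : a <= x -> t <= G x -> Q t <= x.
  move=> ax tG; apply: ge_sup; first by exists a.
  move=> y [->//|[yab yt]]; rewrite leNgt; apply/negP => /ltW/Gnd.
  by rewrite leNgt (lt_le_trans yt).
have GQ x t : a <= x <= b -> ~ t <= G x -> x <= Q t.
  by move=> xab /negP; rewrite -ltNge => Gt; apply: sup_upper_bound => //; right.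
have [|//|q hq] := @lottery_of_quantile R a b ab Q.
  exact: nondecreasing_measurable.
exists q => h ch; apply/cvgrPdist_le => e e0.
(* One third for each of the two step approximations, one for the convergence of the sums. *)
have e30 : 0 < e / 3 by rewrite divr_gt0.
have [n [x [x0 xn xnd hx]]] := cont_grid ab ch e30.
have xab i : (i < n)%N -> a <= x i <= b.
  by move=> iN; rewrite -x0 -xn !xnd// ltnW.
have xa i : a <= x i by rewrite -x0 xnd.
(* This sum reads the distribution function at finitely many grid points only, so pointwise
   convergence of [F k] to [G] carries over to it. *)
pose s (w : R -> R) := h b + \sum_(i < n) (h (x i) - h (x i.+1)) * w (x i).
have qs : `|expect q h - s G| <= e / 3.
  rewrite hq//.
  have := @Rintegral_step_approx _ _ _ (uniform_prob (@ltr01 R)) a b h Q x n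
    (fun i => [set t | t <= G (x i)]) (e / 3) ab ch.
  have mG i : measurable [set t : R | t <= G (x i)].
    by rewrite -[X in measurable X]/(`]-oo, G (x i)]%classic).
  move=> /(_ (nondecreasing_measurable measurableT Qnd) Qab x0 xn xnd hx mG).
  rewrite /s; under eq_bigr do rewrite uniform_le ?(HG _).1//.
  apply.
  - by move=> i t /= /le_trans; apply; apply/Gnd/xnd.
  - by move=> i t; exact: QG.
  - by move=> i t iN; apply: GQ; exact: xab.
have ps k : `|expect (p k) h - s (F k)| <= e / 3.
  rewrite expect_clip//.
  apply: (@Rintegral_step_approx _ _ _ _ a b h (clip a b) x n
    (fun i => [set y | clip a b y <= x i])) => //.
  - exact: measurable_clip.
  - by move=> t; exact: clip_in.
  - by move=> i t /= /le_trans; apply; apply: xnd.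
  - by move=> i t _ /= /negP; rewrite -ltNge => /ltW.
have sc : s (F k) @[k --> U] --> s G.
  apply: cvgD; first exact: cvg_cst.
  apply: cvg_big => [|i _]; first exact: add_continuous.
  by apply: cvgM; [exact: cvg_cst|exact: (HG _).2].
move/cvgrPdist_le : sc => /(_ _ e30); apply: filterS => k sk.
have := ps k; have := qs; have := sk; rewrite !ler_norml.
by move=> /andP[? ?] /andP[? ?] /andP[? ?]; apply/andP; split; lra.
Qed.

End Compactness.

(** * Standard preferences: bounds and convergence of representations *)

Section StandardPreferences.
Context {R : realType} (a b : R) (S : finType).
Hypothesis ab : a <= b.
Implicit Types (P : act a b S -> act a b S -> Prop) (V : act a b S -> R).

(** Every act dominates the point mass at [a], of value 0, and is dominated by the point mass at
    [b], of value 1. *)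
Lemma std_rep_bounds P V u f : weakly_monotone P -> std_rep V u ->
  represents V P -> 0 <= V f <= 1.
Proof.
move=> mP [_ [[cu [_ [ua ub]]] Vc]] rP.
have [da hda] := exists_dirac_lottery ab (x := a) ltac:(by rewrite lexx ab).
have [db hdb] := exists_dirac_lottery ab (x := b) ltac:(by rewrite lexx ab).
have ccst (r : R) : cont_ab a b (fun=> r).
  by apply: continuous_subspaceT => x; exact: cvg_cst.
have hVa : V (const_act da) = 0 by rewrite Vc hda.
have hVb : V (const_act db) = 1 by rewrite Vc hdb.
rewrite -{1}hVa -{1}hVb; apply/andP; split; apply/rP/mP => s h ch hm.
- rewrite /const_act hda// -[leLHS](expect_cst ab (f s)) expect_le// => x /andP[ax xb].
  by apply: hm => //; rewrite in_itv/= ?lexx ?ax ?ab.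
- rewrite /const_act hdb// -[leRHS](expect_cst ab (f s)) expect_le// => x /andP[ax xb].
  by apply: hm => //; rewrite in_itv/= ?lexx ?ax ?ab.
Qed.

(** * Acts converging along an ultrafilter that contains every tail of the indices *)

Section Limit.
Variables (U : set_system nat) (UU : UltraFilter U).
Hypothesis Uoo : \oo `<=` U.
Variables (fk : nat -> act a b S) (f : act a b S).
Hypothesis fkf : forall s h, cont_ab a b h ->
  expect (fk k s) h @[k --> U] --> expect (f s) h.

(** A basic neighbourhood imposes one condition for each test function and state; these are finitely
    many, so they hold together on a set of [U]. *)
Lemma near_wnbhd n (hs : 'I_n -> R -> R) e : admissible a b hs e ->
  \forall k \near U, wnbhd hs e f (fk k).
Proof.
move=> [chs e0]; apply: filter_forall => j; apply: filter_forall => s.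
by have /cvgrPdist_lt/(_ e e0) := @fkf s _ (chs j); apply: filterS => k; rewrite distrC.
Qed.

Lemma contX_ultra_cvg V : contX V -> V (fk k) @[k --> U] --> V f.
Proof.
move=> cV; apply/cvgrPdist_lt => e e0.
have [n [hs [d [adm hd]]]] := cV f e e0.
by apply: filterS (near_wnbhd adm) => k /hd; rewrite distrC.
Qed.

(** A set of [U] meets every tail, hence contains arbitrarily large indices, as [Ls] asks. The two
    halves serve the upper and the lower bound. *)
Lemma Ls_ultra_pair (Fk : nat -> act a b S * act a b S -> Prop) (g : act a b S) :
  ((\forall k \near U, Fk k (fk k, g)) -> Ls Fk (f, g)) /\
  ((\forall k \near U, Fk k (g, fk k)) -> Ls Fk (g, f)).
Proof.
have gg n (hs : 'I_n -> R -> R) e : admissible a b hs e -> wnbhd hs e g g.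
  by move=> [_ e0] j s; rewrite subrr normr0.
split=> UF n hs e adm K.
  have /filter_ex[k [Kk fw kF]] :
      \forall k \near U, [/\ (K <= k)%N, wnbhd hs e f (fk k) & Fk k (fk k, g)].
    by apply: filterS3 (Uoo (nbhs_infty_ge K)) (near_wnbhd adm) UF => k.
  by exists k; split => //; exists (fk k, g); split => //; split => //=; exact: gg.
have /filter_ex[k [Kk fw kF]] :
    \forall k \near U, [/\ (K <= k)%N, wnbhd hs e f (fk k) & Fk k (g, fk k)].
  by apply: filterS3 (Uoo (nbhs_infty_ge K)) (near_wnbhd adm) UF => k.
by exists k; split => //; exists (g, fk k); split => //; split => //=; exact: gg.
Qed.

Lemma std_rep_ultra_cvg P V u (Pk : nat -> act a b S -> act a b S -> Prop)
    (Vk : nat -> act a b S -> R) (uk : nat -> R -> R) :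
  weakly_monotone P -> std_rep V u -> represents V P ->
  (forall k, weakly_monotone (Pk k)) -> (forall k, std_rep (Vk k) (uk k)) ->
  (forall k, represents (Vk k) (Pk k)) ->
  closed_conv (fun k => pref_set (Pk k)) (pref_set P) ->
  Vk k (fk k) @[k --> U] --> V f.
Proof.
move=> mP sV rP mPk sVk rPk cc.
have /andP[Vf0 Vf1] := std_rep_bounds f mP sV rP.
have Vk01 k := std_rep_bounds (fk k) (mPk k) (sVk k) (rPk k).
have [_ [Uu Vc]] := sV.
have Vkc k p : Vk k (const_act p) = expect p (uk k) by have [_ [_ ->]] := sVk k.
have Uuk k : in_U a b (uk k) by have [_ []] := sVk k.
apply/cvgrPdist_lt => e e0.
have up : \forall k \near U, Vk k (fk k) < V f + e.
  (* If the bound fails on [U], the reverse inequality holds on a set of [U]. *)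
  have [//|UN] := in_ultra_setVsetC [set k | Vk k (fk k) < V f + e] UU.
  have {}UN : \forall k \near U, V f + e <= Vk k (fk k).
    by apply: filterS UN => k /= /negP; rewrite -leNgt.
  (* A single such index already puts [V f + e] below 1, so a lottery on [{a, b}] of that value
     exists. *)
  have /filter_ex[k0 hk0] := UN.
  have t01 : 0 <= V f + e <= 1 by have := Vk01 k0; lra.
  have [m hm] := exists_binary_lottery ab t01.
  have : pref_set P (f, const_act m).
    apply/(cc _).2/(Ls_ultra_pair _ _).1; apply: filterS UN => k hk.
    by apply/rPk; rewrite Vkc hm.
  by move=> /rP; rewrite Vc hm//; lra.
have lo : \forall k \near U, V f - e < Vk k (fk k).
  have [//|UN] := in_ultra_setVsetC [set k | V f - e < Vk k (fk k)] UU.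
  have {}UN : \forall k \near U, Vk k (fk k) <= V f - e.
    by apply: filterS UN => k /= /negP; rewrite -leNgt.
  (* Here the index shows that [V f - e] is nonnegative. *)
  have /filter_ex[k0 hk0] := UN.
  have t01 : 0 <= V f - e <= 1 by have := Vk01 k0; lra.
  have [m hm] := exists_binary_lottery ab t01.
  have : pref_set P (const_act m, f).
    apply/(cc _).2/(Ls_ultra_pair _ _).2; apply: filterS UN => k hk.
    by apply/rPk; rewrite Vkc hm.
  by move=> /rP; rewrite Vc hm//; lra.
by apply: filterS2 up lo => k h1 h2; rewrite ltr_norml; apply/andP; split; lra.
Qed.

End Limit.

Lemma closed_conv_unif_X P V u (Pk : nat -> act a b S -> act a b S -> Prop)
    (Vk : nat -> act a b S -> R) (uk : nat -> R -> R) :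
  weakly_monotone P -> std_rep V u -> represents V P ->
  (forall k, weakly_monotone (Pk k)) -> (forall k, std_rep (Vk k) (uk k)) ->
  (forall k, represents (Vk k) (Pk k)) ->
  closed_conv (fun k => pref_set (Pk k)) (pref_set P) ->
  unif_X Vk V.
Proof.
move=> mP sV rP mPk sVk rPk cc e e0; apply: contrapT => bad.
have /choice[phi hphi] : forall K, exists k, (K <= k)%N /\
    exists f, e <= `|Vk k f - V f|.
  move=> K; apply: contrapT => noK; apply: bad; exists K => k Kk f.
  by rewrite ltNge; apply/negP => ef; apply: noK; exists k; split => //; exists f.
(* Refining the image of the tails under [phi] makes [U] contain both the tails (as [K <= phi K])
   and the set of indices where the error is at least [e] at some act. *)
have [U [UU phiU]] := ultraFilterLemma (fmap_proper_filter phi eventually_filter).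
have Uoo : \oo `<=` U.
  move=> A [K _ KA]; apply: phiU; exists K => // k /= Kk.
  by apply: KA => /=; apply: leq_trans Kk (hphi k).1.
have [da _] := exists_dirac_lottery ab (x := a) ltac:(by rewrite lexx ab).
(* At an index without a bad act, an arbitrary constant act is the default value. *)
have /choice[fk hfk] : forall k, exists f,
    (exists f, e <= `|Vk k f - V f|) -> e <= `|Vk k f - V f|.
  move=> k; have [[f ef]|nf] := pselect (exists f, e <= `|Vk k f - V f|).
    by exists f.
  by exists (const_act da).
have Ubad : \forall k \near U, e <= `|Vk k (fk k) - V (fk k)|.
  by apply: phiU; exists 0%N => // K _; apply: hfk; exact: (hphi K).2.
(* Compactness is applied in each state separately. Then [V] and [Vk] along [fk] share the limit
   [V f], so their difference cannot stay at least [e] in absolute value. *)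
have /choice[f hf] := fun s => @lottery_ultra_compact R U UU a b ab (fun k => fk k s).
have c1 := contX_ultra_cvg UU hf sV.1.
have c2 := std_rep_ultra_cvg UU Uoo hf mP sV rP mPk sVk rPk cc.
have : Vk k (fk k) - V (fk k) @[k --> U] --> V f - V f by exact: cvgB.
rewrite subrr => /cvgrPdist_lt/(_ e e0) close.
have /filter_ex[k] : \forall k \near U, False.
  by apply: filterS2 Ubad close => k ef; rewrite sub0r normrN ltNge ef.
by [].
Qed.

End StandardPreferences.

(** * From convergence on acts to convergence of utilities and aggregators *)

Theorem mainTheorem1 (R : realType) (a b : R) (S : finType)
  (hab : a < b) (hS : (0 < #|S|)%N)
  (P : act a b S -> act a b S -> Prop) (V : act a b S -> R) (u : R -> R)
  (Pk : nat -> act a b S -> act a b S -> Prop)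
  (Vk : nat -> act a b S -> R) (uk : nat -> R -> R) :
  standard_pref P -> std_rep V u -> represents V P ->
  (forall k, standard_pref (Pk k)) ->
  (forall k, std_rep (Vk k) (uk k)) ->
  (forall k, represents (Vk k) (Pk k)) ->
  closed_conv (fun k => pref_set (Pk k)) (pref_set P) ->
  (unif_ab a b uk u /\ unif_X Vk V) /\
  (forall (H : (S -> R) -> R) (Hk : nat -> (S -> R) -> R),
     aggregative V u H -> (forall k, aggregative (Vk k) (uk k) (Hk k)) ->
     unif_cube Hk H).
Proof.
move=> sP sV rP sPk sVk rPk cc; have ab := ltW hab.
have uX := closed_conv_unif_X ab sP.2.1 sV rP (fun k => (sPk k).2.1) sVk rPk cc.
split; first split=> //.
  move=> e /uX[K hK]; exists K => k Kk x; rewrite in_itv => /= xab.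
  (* On the constant act at this point mass, [V] and [Vk k] take the values [u x] and [uk k x]; the
     index [K] does not depend on [x]. *)
  have [q hq] := exists_dirac_lottery ab xab.
  have [_ [[cu _] Vc]] := sV; have [_ [[cuk _] Vkc]] := sVk k.
  by have := hK k Kk (const_act q); rewrite Vc Vkc !hq.
move=> H Hk [_ VH] aHk e /uX[K hK]; exists K => k Kk z z01.
(* This act has utility vector [z] under [u] and under every [uk k] alike, so [H] and [Hk k] are
   compared at the same point [z]. *)
have /choice[f hf] := fun s => exists_binary_lottery ab (z01 s).
have [_ [Uu _]] := sV; have [_ [Uuk _]] := sVk k.
have := hK k Kk f; rewrite VH (aHk k).2.
rewrite (_ : (fun s => expect (f s) (uk k)) = z); last by apply/funext => s; exact: hf.
by rewrite (_ : (fun s => expect (f s) u) = z)//; apply/funext => s; exact: hf.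
Qed.
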